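(* Let $G$ be a graph and let $V_1\cup V_2\cup\cdots\cup V_k$ be a partition of $V(G)$ into independent sets such that $\phi(V_j,V_i)=\emptyset$ whenever $j>i$. If $k$ is even, let $$H=\left(V_1V_2\cup V_3V_4\cup\cdots\cup V_{k-1}V_k\right)\cup\left(\phi(V_1,V_2)\phi(V_1,V_2)\cup\cdots\cup\phi(V_{k-1},V_k)\phi(V_{k-1},V_k)\right).$$ If $k$ is odd, let $$H=\left(V_1V_2\cup V_3V_4\cup\cdots\cup V_{k-2}V_{k-1}\right)\cup V_kV_k\cup\left(\phi(V_1,V_2)\phi(V_1,V_2)\cup\cdots\cup\phi(V_{k-2},V_{k-1})\phi(V_{k-2},V_{k-1})\right).$$ Then $H$ is a maximal independent set of $T_2(G)$.
   Context: All graphs are finite and simple. The $2$-token graph $T_2(G)$ has as vertices the $2$-subsets of $V(G)$, two of them adjacent if their symmetric difference is an edge of $G$. For subsets $A,B\subseteq V(G)$ (not necessarily distinct), $AB=\{\{a,b\} : a\in A,\ b\in B,\ a\neq b\}$, a set of vertices of $T_2(G)$; in particular $AA$ is the set of 2-subsets of $A$. For disjoint independent sets $A,B$ of $G$, $\phi(A,B)=\{x\in A : B\cup\{x\} \text{ is an independent set of } G\}$. A maximal independent set is an independent set not properly contained in another independent set. *)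

(* Defs.v *)
From HB Require Import structures.
From mathcomp Require Import all_boot.

Set Implicit Arguments.
Unset Strict Implicit.
Unset Printing Implicit Defensive.

Record sgraph := SGraph {
  vertex :> finType;
  adj : rel vertex;
  adj_sym : symmetric adj;
  adj_irrefl : irreflexive adj }.

Section Graph.
Variable G : sgraph.
Implicit Types A B : {set G}.

Definition independent A : bool :=
  [forall x in A, forall y in A, ~~ adj x y].

Definition maximal_independent A : Prop :=
  independent A /\ (forall B, independent B -> ~~ (A \proper B)).

(* Only meaningful when A and B are disjoint independent sets. *)
Definition phi A B : {set G} := [set x in A | independent (x |: B)].

Definition vertex2 := {A : {set G} | #|A| == 2}.

Definition adj2 : rel vertex2 := fun u v =>
  [exists x, exists y,
    adj x y && ((val u :\: val v) :|: (val v :\: val u) == [set x; y])].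

Lemma adj2_sym : symmetric adj2.
Proof. by move=> u v; rewrite /adj2 setUC. Qed.

Lemma adj2_irrefl : irreflexive adj2.
Proof.
move=> u; apply/existsP => -[x /existsP[y /andP[_]]].
by rewrite setDv setU0 => /eqP/setP/(_ x); rewrite !inE eqxx.
Qed.

Definition token2 : sgraph := SGraph adj2_sym adj2_irrefl.

Definition pairs A B : {set token2} :=
  [set u : token2 | [exists a in A, exists b in B,
                       (a != b) && (val (u : vertex2) == [set a; b])]].

(* Families are indexed from 1; the values of V outside 1, ..., k are junk. *)
Definition partition_family (k : nat) (V : nat -> {set G}) : Prop :=
  [/\ forall i, 1 <= i <= k -> V i != set0,
      forall i j, 1 <= i <= k -> 1 <= j <= k -> i != j ->
        [disjoint V i & V j]
    & \bigcup_(1 <= i < k.+1) V i = [set: G]].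

(* The odd i with 1 <= i < k are 1, 3, ..., k - 1 when k is even and
   1, 3, ..., k - 2 when k is odd. *)
Definition Hset (k : nat) (V : nat -> {set G}) : {set token2} :=
  if odd k then
    (\bigcup_(1 <= i < k | odd i) pairs (V i) (V i.+1))
      :|: pairs (V k) (V k)
      :|: (\bigcup_(1 <= i < k | odd i)
             pairs (phi (V i) (V i.+1)) (phi (V i) (V i.+1)))
  else
    (\bigcup_(1 <= i < k | odd i) pairs (V i) (V i.+1))
      :|: (\bigcup_(1 <= i < k | odd i)
             pairs (phi (V i) (V i.+1)) (phi (V i) (V i.+1))).

End Graph.

(* Main.v *)
Require Import Defs.
From mathcomp Require Import all_boot zify.

(** Padding the partition with [V_(k+1) = set0] makes the two parities of [k]
    uniform, since [phi (V_k) set0 = V_k]: a pair lies in [H] iff, for some odd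
    [i], it lies in [V_i V_(i+1)] or in [phi (V_i, V_(i+1))] squared.
    Independence: if [ab] and [ac] are in [H] they come from the same [i], and
    an edge [bc] would have to join [V_i] to [V_(i+1)], which [phi] excludes.
    Maximality: let [ab] be outside [H], with [a] in [V_p], [b] in [V_q] and
    [p <= q].  The hypothesis on [phi] (or, if [p = q] is odd, the failure of
    [a] or [b] to be in [phi]) gives a neighbour [c] of one of the two tokens
    in the class paired with [V_p], so moving that token to [c] lands in [H]. *)

Set Implicit Arguments.
Unset Strict Implicit.
Unset Printing Implicit Defensive.

(** The unions in [Hset] run over an interval of [nat], that is, over a filtered list. *)
Lemma mem_bigcup_seqP (I : eqType) (T : finType) (r : seq I) (P : pred I)
    (F : I -> {set T}) (x : T) :
  reflect (exists i, [/\ i \in r, P i & x \in F i])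
          (x \in \bigcup_(i <- r | P i) F i).
Proof.
have -> : (x \in \bigcup_(i <- r | P i) F i)
        = has (fun i => P i && (x \in F i)) r.
  elim: r => [|i r IHr]; first by rewrite big_nil inE.
  by rewrite big_cons /=; case: (P i); rewrite ?inE IHr.
apply: (iffP hasP) => [[i ri /andP[Pi xi]]|[i [ri Pi xi]]]; exists i => //.
by apply/andP.
Qed.

(** * Edges of the 2-token graph and membership in [Hset] *)

Section TokenGraph.
Variable G : sgraph.
Implicit Types (A B : {set G}) (a b c x y : G) (u v : token2 G).

Lemma independentP A :
  reflect {in A &, forall x y, ~~ adj x y} (independent A).
Proof.
apply: (iffP forall_inP) => [hA x y xA yA|hA x xA].
  exact: (forall_inP (hA x xA)).
by apply/forall_inP => y yA; apply: hA.
Qed.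

Lemma independent0 : independent (set0 : {set G}).
Proof. by apply/independentP => x y; rewrite inE. Qed.

(** [phi] tests the whole set [x |: B]; once [B] is independent, only edges at [x] can spoil it. *)
Lemma phiP A B x : independent B ->
  reflect (x \in A /\ {in B, forall y, ~~ adj x y}) (x \in phi A B).
Proof.
move=> /independentP hB; rewrite inE.
apply: (iffP andP) => -[xA hx]; split=> //.
  move=> y yB; move/independentP: hx; apply; rewrite !inE ?eqxx //.
  by rewrite yB orbT.
apply/independentP => y z; rewrite !inE.
case/predU1P=> [->|yB] /predU1P[->|zB]; rewrite ?adj_irrefl //; try exact: hx.
  by rewrite adj_sym; apply: hx.
exact: hB.
Qed.

Lemma notin_phi A B x : independent B -> x \in A -> x \notin phi A B ->
  exists2 y, y \in B & adj x y.
Proof.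
move=> hB xA hx; apply/exists_inP; apply: contraNT hx => /exists_inPn hx.
by apply/phiP.
Qed.

Lemma phi_set0 A : phi A set0 = A.
Proof.
apply/setP => x; apply/(phiP _ _ independent0)/idP => [[]|xA] //.
by split=> // y; rewrite inE.
Qed.

Lemma vertex2P u : exists a b, a != b /\ val (u : vertex2 G) = [set a; b].
Proof. by case: u => A hA; apply/cards2P. Qed.

(** By counting: the two differences are disjoint with union an edge, so their sizes add up to 2.
    Both sets have size 2, so the differences have equal size, hence size 1, which leaves one common
    element. *)
Lemma adj2P u v : adj u v ->
  exists a b c, [/\ a != b, a != c, adj b c,
     val (u : vertex2 G) = [set a; b] & val (v : vertex2 G) = [set a; c]].
Proof.
case: u v => A hA [B hB] /existsP[x /existsP[y /andP[xy]]] /= /eqP eD.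
have nxy : x != y by apply: contraTneq xy => ->; rewrite adj_irrefl.
have cA := cardsID B A; have cB := cardsID A B.
have dAB : (A :\: B) :&: (B :\: A) = set0.
  by apply/setP => z; rewrite !inE; case: (z \in A); case: (z \in B).
have cD : #|A :\: B| + #|B :\: A| = 2.
  by rewrite -cardsUI dAB cards0 addn0 eD cards2 nxy.
move/eqP: (hA) cA => -> cA; move/eqP: (hB) cB; rewrite setIC => -> cB.
have /eqP/cards1P[b eb] : #|A :\: B| = 1 by lia.
have /eqP/cards1P[c ec] : #|B :\: A| = 1 by lia.
have /eqP/cards1P[a ea] : #|A :&: B| = 1 by lia.
have [aA aB] : a \in A /\ a \in B by apply/setIP; rewrite ea set11.
have [bA bB] : b \in A /\ b \notin B by apply/setDP; rewrite eb set11.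
have [cB' cA'] : c \in B /\ c \notin A by apply/setDP; rewrite ec set11.
exists a, b, c; split.
- by apply: contraNneq bB => <-.
- by apply: contraNneq cA' => <-.
- move: eD; rewrite eb ec => e.
  have nbc : b != c by apply: contraNneq cA' => <-.
  have : b \in [set x; y] by rewrite -e set21.
  have : c \in [set x; y] by rewrite -e set22.
  rewrite !inE => /pred2P[] ? /pred2P[] ?; subst; rewrite ?eqxx // in nbc *.
  by rewrite adj_sym.
- by rewrite -(setID A B) ea eb.
- by rewrite -(setID B A) setIC ea ec.
Qed.

Lemma adj_token2 a b c u v : a != b -> a != c -> adj b c ->
  val (u : vertex2 G) = [set a; b] -> val (v : vertex2 G) = [set a; c] ->
  adj u v.
Proof.
move=> nab nac bc eu ev; apply/existsP; exists b; apply/existsP; exists c.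
have nbc : b != c by apply: contraTneq bc => ->; rewrite adj_irrefl.
rewrite bc eu ev; apply/eqP/setP => z; rewrite !inE.
case: (eqVneq z a) => [->|_] /=; first by rewrite (negPf nab) (negPf nac).
by case: (eqVneq z b) => [->|_] /=; rewrite ?(negPf nbc) ?andbF ?andbT ?orbF.
Qed.

Lemma pairsP A B u a b : a != b -> val (u : vertex2 G) = [set a; b] ->
  reflect (a \in A /\ b \in B \/ b \in A /\ a \in B) (u \in pairs A B).
Proof.
move=> nab eu; rewrite inE; apply: (iffP exists_inP).
  case=> x xA /exists_inP[y yB /andP[nxy]]; rewrite eu => /eqP e.
  have : a \in [set x; y] by rewrite -e set21.
  have : b \in [set x; y] by rewrite -e set22.
  rewrite !inE => /pred2P[] ? /pred2P[] ?; subst; rewrite ?eqxx // in nab *;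
  by [left|right].
case=> [] [xA xB]; [exists a => // | exists b => //];
  apply/exists_inP; [exists b => // | exists a => //].
  by rewrite nab eu eqxx.
by rewrite eq_sym nab eu setUC eqxx.
Qed.

Lemma pairs_set0 A : pairs A set0 = set0.
Proof.
apply/setP => u; have [a [b [nab eu]]] := vertex2P u.
by rewrite in_set0; apply/(pairsP _ _ nab eu); rewrite !inE; case=> -[].
Qed.

(** [V k.+1] is arbitrary, so emptiness beyond [k] has to be imposed. *)
Definition padded (k : nat) (V : nat -> {set G}) (i : nat) : {set G} :=
  if i <= k then V i else set0.

Lemma in_padded k V i x : x \in padded k V i -> i <= k /\ x \in V i.
Proof. by rewrite /padded; case: ifP => //; rewrite inE. Qed.

Lemma HsetP k V u :
  reflect (exists i, [/\ odd i, i <= k &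
             (u \in pairs (V i) (padded k V i.+1))
             || (u \in pairs (phi (V i) (padded k V i.+1))
                             (phi (V i) (padded k V i.+1)))])
          (u \in Hset k V).
Proof.
have pad i : i < k -> padded k V i.+1 = V i.+1 by rewrite /padded => ->.
have padk : padded k V k.+1 = set0 by rewrite /padded ltnn.
have bigP (F : nat -> {set token2 G}) :
    reflect (exists i, [/\ odd i, i < k & u \in F i])
            (u \in \bigcup_(1 <= i < k | odd i) F i).
  apply: (iffP (mem_bigcup_seqP _ _ _ _)) => -[i [ri oi ui]]; exists i;
  by rewrite mem_index_iota in ri *; split=> //; lia.
apply: (iffP idP).
  rewrite /Hset; case: ifP => ok; rewrite !in_setU.
    case/orP=> [/orP[/bigP[i [oi ik ui]]|uk]|/bigP[i [oi ik ui]]].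
    - by exists i; rewrite (pad _ ik) ui ltnW.
    - by exists k; rewrite padk phi_set0 uk orbT.
    - by exists i; rewrite (pad _ ik) ui orbT ltnW.
  by case/orP=> /bigP[i [oi ik ui]]; exists i; rewrite (pad _ ik) ui ?orbT ltnW.
case=> i [oi]; rewrite leq_eqVlt => /predU1P[eik|ik].
  (* For [i = k] the first kind of pair is void and the second is [pairs (V k) (V k)]; as [i] is
     odd, so is [k], and [Hset] has that term. *)
  rewrite eik padk pairs_set0 phi_set0 in_set0 /= => uk.
  by rewrite /Hset -{1}eik oi !in_setU uk orbT.
rewrite (pad _ ik) /Hset => /orP[] ui; case: ifP => _; rewrite !in_setU.
- by apply/orP; left; apply/orP; left; apply/bigP; exists i.
- by apply/orP; left; apply/bigP; exists i.
- by apply/orP; right; apply/bigP; exists i.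
- by apply/orP; right; apply/bigP; exists i.
Qed.

End TokenGraph.

(** * Independence and maximality of [Hset] for the given partition *)

Section Partition.
Variables (G : sgraph) (k : nat) (V : nat -> {set G}).
Hypothesis hpart : partition_family k V.
Hypothesis hind : forall i : nat, 1 <= i <= k -> independent (V i).
Hypothesis hphi : forall i j : nat, 1 <= i -> i < j -> j <= k ->
  phi (V j) (V i) = set0.

Lemma partition_class x : exists2 i, 1 <= i <= k & x \in V i.
Proof.
have [_ _ /setP/(_ x)] := hpart; rewrite inE => /mem_bigcup_seqP[i [ri _ xi]].
by exists i => //; rewrite mem_index_iota in ri.
Qed.

Lemma partition_class_inj x i j : 1 <= i <= k -> 1 <= j <= k ->
  x \in V i -> x \in V j -> i = j.
Proof.
have [_ dV _] := hpart => hi hj xi xj; apply/eqP/contraT => nij.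
by have /disjointFr/(_ xi) := dV i j hi hj nij; rewrite xj.
Qed.

Lemma padded_independent i : 0 < i -> independent (padded k V i).
Proof.
move=> i0; rewrite /padded; case: ifP => ik; last exact: independent0.
by apply: hind; rewrite i0.
Qed.

(** Emptiness of [phi (V j) (V i)] prevents [x] from extending the independent set [V i]. This is
    the form in which [hphi] enters the maximality argument. *)
Lemma earlier_neighbor i j x : 1 <= i -> i < j -> j <= k -> x \in V j ->
  exists2 y, y \in V i & adj x y.
Proof.
move=> i1 ij jk xj; apply: notin_phi xj _; last by rewrite hphi // inE.
by apply: hind; rewrite i1 (leq_trans (ltnW ij)).
Qed.

(** Naming both tokens records which class holds [a], so that two pairs sharing [a] can be
    compared. *)
Lemma Hset_pairP u a b : a != b -> val (u : vertex2 G) = [set a; b] ->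
  u \in Hset k V ->
  exists i, [/\ odd i, i <= k &
    [\/ a \in V i /\ b \in padded k V i.+1,
        b \in V i /\ a \in padded k V i.+1
      | a \in phi (V i) (padded k V i.+1) /\
        b \in phi (V i) (padded k V i.+1)]].
Proof.
move=> nab eu /HsetP[i [oi ik h]]; exists i; split=> //.
case/orP: h => /(pairsP _ _ nab eu)[] [h1 h2].
- by constructor 1.
- by constructor 2.
- by constructor 3.
- by constructor 3.
Qed.

Lemma Hset_independent : independent (Hset k V).
Proof.
apply/independentP => u v uH vH; apply/negP.
case/adj2P=> a [b [c [nab nac bc eu ev]]].
have [i [oi ik hi]] := Hset_pairP nab eu uH.
have [j [oj jk hj]] := Hset_pairP nac ev vH.
have iP := padded_independent (ltn0Sn i).
have jP := padded_independent (ltn0Sn j).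
have nadj l x y : 1 <= l <= k -> x \in V l -> y \in V l -> ~~ adj x y.
  by move=> hl; apply: (independentP _ (hind hl)).
have i1 : 1 <= i <= k by rewrite odd_gt0.
have j1 : 1 <= j <= k by rewrite odd_gt0.
move: bc; apply/negP.
(* Nine cases by the place of [a] in each pair. Four put [a] in both an odd and an even class, which
   is impossible. In the others [i = j]: three put [b] and [c] in one independent set, and two are
   excluded by [phi]. *)
case: hi => [[ai bi]|[bi ai]|[/(phiP _ _ iP)[ai _] /(phiP _ _ iP)[bi bP]]];
case: hj => [[aj cj]|[cj aj]|[/(phiP _ _ jP)[aj _] /(phiP _ _ jP)[cj cP]]];
try (have [ik' ai'] := in_padded ai); try (have [jk' aj'] := in_padded aj).
- have e := partition_class_inj i1 j1 ai aj; subst j.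
  exact: (independentP _ iP).
- have e := partition_class_inj i1 (j := j.+1) jk' ai aj'.
  by move: oi; rewrite e /= oj.
- have e := partition_class_inj i1 j1 ai aj; subst j.
  by rewrite adj_sym cP.
- have e := partition_class_inj j1 (j := i.+1) ik' aj ai'.
  by move: oj; rewrite e /= oi.
- have e := partition_class_inj (i := i.+1) (j := j.+1) ik' jk' ai' aj'.
  by case: e => e; subst j; apply: nadj bi cj.
- have e := partition_class_inj j1 (j := i.+1) ik' aj ai'.
  by move: oj; rewrite e /= oi.
- have e := partition_class_inj i1 j1 ai aj; subst j.
  exact: bP.
- have e := partition_class_inj i1 (j := j.+1) jk' ai aj'.
  by move: oi; rewrite e /= oj.
- have e := partition_class_inj i1 j1 ai aj; subst j.
  exact: nadj bi cj.
Qed.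

(** Supplies the target of every token move below: two consecutive classes paired in [Hset]. *)
Lemma Hset_pair a c i : odd i -> i < k -> a != c ->
  (a \in V i /\ c \in V i.+1) \/ (c \in V i /\ a \in V i.+1) ->
  exists2 v, v \in Hset k V & val (v : vertex2 G) = [set a; c].
Proof.
move=> oi ik nac h; have hc : #|[set a; c]| == 2 by rewrite cards2 nac.
exists (exist (fun A : {set G} => #|A| == 2) _ hc) => //.
apply/HsetP; exists i; split=> //; first exact: ltnW.
by apply/orP; left; apply/pairsP; [exact: nac| |rewrite /padded ik].
Qed.

(** Domination of all outside vertices is what makes an independent set maximal. *)
Lemma Hset_dominating u : u \notin Hset k V ->
  exists2 v, v \in Hset k V & adj u v.
Proof.
move=> uH; have [a [b [nab eu]]] := vertex2P u.
have [p hp ap] := partition_class a; have [q hq bq] := partition_class b.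
wlog pq : a b p q nab eu hp ap hq bq / p <= q.
  move=> W; have [le_pq|/ltnW le_qp] := leqP p q; first exact: (W a b p q).
  by apply: (W b a q p); rewrite // 1?eq_sym // setUC.
(* Common ending of the cases: [a'] stays and the other token slides from [b'] to [c]. The tokens do
   not collide, because they lie in different classes. *)
have move_token a' b' c i : a' != b' -> val (u : vertex2 G) = [set a'; b'] ->
    adj b' c -> odd i -> i < k ->
    (a' \in V i /\ c \in V i.+1) \/ (c \in V i /\ a' \in V i.+1) ->
    exists2 v, v \in Hset k V & adj u v.
  move=> nab' eu' bc oi ik h.
  have i1 : 1 <= i <= k by rewrite odd_gt0 // ltnW.
  have nac : a' != c.
    case: h => -[h1 h2]; apply/eqP => e; subst c;
    by case: (n_Sn _ (partition_class_inj i1 (j := i.+1) ik h1 h2)).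
  have [v vH ev] := Hset_pair oi ik nac h.
  by exists v => //; exact: adj_token2 nab' nac bc eu' ev.
have [p0 pk] := andP hp; have [q0 qk] := andP hq.
have [op|ep] := boolP (odd p); last first.
  (* For even [p] the partner of [V p] is [V p.-1], which precedes [V q] even when [p = q]; so [b]
     can move there. *)
  have eP := prednK p0.
  have op : odd p.-1 by move: ep; rewrite -eP /= negbK.
  have lt_q : p.-1 < q by rewrite eP.
  have [c cp bc] := earlier_neighbor (odd_gt0 op) lt_q qk bq.
  by apply: (move_token a b c p.-1) => //; [rewrite eP|right; rewrite eP].
(* Now [p] is odd, with partner [V p.+1]. If [p < q], either [q = p.+1] and [u] is already in
   [Hset], or [V p.+1] precedes [V q] and [b] moves into it. *)
have [e|npq] := eqVneq p q; last first.
  have [e|npq'] := eqVneq q p.+1.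
    case/negP: uH; apply/HsetP; exists p; split=> //.
    apply/orP; left; apply/(pairsP _ _ nab eu); left; split=> //.
    by rewrite /padded -e qk.
  have lt_pq : p < q by rewrite ltn_neqAle npq.
  have lt_p1q : p.+1 < q by rewrite ltn_neqAle eq_sym npq'.
  have [c cp bc] := earlier_neighbor (ltn0Sn p) lt_p1q qk bq.
  by apply: (move_token a b c p) => //; [exact: leq_trans lt_pq qk|left].
subst q.
have iP := padded_independent (ltn0Sn p).
(* With both tokens in [V p], one outside [phi] has a neighbour in the padded class; that class is
   then nonempty, which forces [p < k]. If both are in [phi], then [u] is in [Hset]. *)
have [aF|/(notin_phi iP ap)[c /in_padded[lt_pk cp] ac]]
    := boolP (a \in phi (V p) (padded k V p.+1)); last first.
  apply: (move_token b a c p) => //; last by left.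
    by rewrite eq_sym.
  by rewrite setUC.
have [bF|/(notin_phi iP bq)[c /in_padded[lt_pk cp] bc]]
    := boolP (b \in phi (V p) (padded k V p.+1)); last first.
  by apply: (move_token a b c p) => //; left.
case/negP: uH; apply/HsetP; exists p; split=> //.
by apply/orP; right; apply/(pairsP _ _ nab eu); left.
Qed.

Lemma Hset_maximal : maximal_independent (Hset k V).
Proof.
split=> [|B /independentP hB]; first exact: Hset_independent.
apply/negP => /properP[/subsetP HB [u uB /Hset_dominating[v vH uv]]].
by have := hB u v uB (HB v vH); rewrite uv.
Qed.

End Partition.

Theorem theorem3p9 (G : sgraph) (k : nat) (V : nat -> {set G})
  (hpart : partition_family k V)
  (hind : forall i : nat, 1 <= i <= k -> independent (V i))
  (hphi : forall i j : nat, 1 <= i -> i < j -> j <= k ->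
            phi (V j) (V i) = set0) :
  maximal_independent (Hset k V).
Proof. exact: Hset_maximal. Qed.
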